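(* Let $Z\in\mathbb{R}^{n\times m}$ satisfy $Z^TZ=I$. If the randomized Bischof-Stewart column selection algorithm randBSQR is used to select $m$ columns of $Z^T\in\mathbb{R}^{m\times n}$, then (for every outcome of the random sampling) the set $\mathcal{C}\subset\{1,\ldots,n\}$ of selected columns satisfies \[ \sigma_i(Z(\mathcal{C},:))\;\geq\;\frac{1}{\sqrt{1+\frac{i(n-m)}{m-i+1}}} \] for $i=1,\ldots,m$.
   Context: $\sigma_1\ge\sigma_2\ge\cdots$ denote singular values in non-increasing order, and $Z(\mathcal{C},:)$ is the $m\times m$ submatrix of $Z$ consisting of the rows indexed by $\mathcal{C}$. Exact arithmetic is assumed. The algorithm randBSQR. Input: $A\in\mathbb{R}^{m\times n}$ with $AA^T=I$ (here $A=Z^T$), a block size $k_b\ge 1$ (default $k_b=m$), and sampling weights $g_1,\ldots,g_n\ge 0$ with $g_j>0$ whenever the $j$-th column of $A$ is nonzero (default $g_j=\|A(:,j)\|_2^2/m$). It maintains an ordered list $\mathcal{C}$ of selected column indices, with $i=|\mathcal{C}|$, and a number $f$; initially $\mathcal{C}$ is empty, $i=0$, $f=0$. Given the current $\mathcal{C}$ with $i=|\mathcal{C}|$, for an index $j\notin\mathcal{C}$ define the cost as follows. Let $A(:,\mathcal{C})=Q\begin{bmatrix}R\\0\end{bmatrix}$ be the QR factorization (computed by Householder reflectors) with $Q\in\mathbb{R}^{m\times m}$ orthogonal and $R\in\mathbb{R}^{i\times i}$ upper triangular, and let $x=Q^TA(:,j)$. Set $w_j=R^{-1}x(1{:}i)$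 and $\rho_j=\|x(i+1{:}m)\|_2$ (with $\|w_j\|_2=0$ if $i=0$). If $\rho_j>0$, the cost of $j$ is $c_j=(1+\|w_j\|_2^2)/\rho_j^2$. While $|\mathcal{C}|<m$, do the following. (1) Set $\hat{\mathcal{J}}=\{1,\ldots,n\}\setminus\mathcal{C}$. (2) Repeat the following until at least one column has been selected since step (1). (2a) Sample a block $\mathcal{B}$ of $\min(k_b,|\hat{\mathcal{J}}|)$ distinct indices from $\hat{\mathcal{J}}$ at random without replacement, according to the weights $g$; let $\mathcal{S}=\mathcal{B}$. (2b) If $\rho_j=0$ for all $j\in\mathcal{S}$, replace $\hat{\mathcal{J}}$ by $\hat{\mathcal{J}}\setminus\mathcal{B}$ and sample a new block. (2c) Otherwise, while $|\mathcal{C}|<m$, $\mathcal{S}\neq\emptyset$ and $\max_{j\in\mathcal{S}}\rho_j>0$: choose $\ell\in\mathcal{S}$ minimizing $c_j$ over $j\in\mathcal{S}$ with $\rho_j>0$, and put $c=c_\ell$. If \[ f+c>\frac{m-i+1}{m-i}f+\frac{n-2i}{m-i}, \] reject: replace $\hat{\mathcal{J}}$ by $\hat{\mathcal{J}}\setminus\mathcal{B}$ and leave loop (2c). Otherwise accept: append $\ell$ to $\mathcal{C}$, remove $\ell$ from $\mathcal{S}$, replace $f$ by $f+c$ and $i$ by $i+1$, and update $w_j,\rho_j,c_j$ for the remaining $j\in\mathcal{S}$ with respect to the new $\mathcal{C}$. When $|\mathcal{C}|=m$, return $\mathcal{C}$. *)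

(* Defs.v *)
From HB Require Import structures.
From mathcomp Require Import all_boot all_order all_algebra.
From mathcomp Require Import reals polyrcf.

Set Implicit Arguments.
Unset Strict Implicit.
Unset Printing Implicit Defensive.

Import Order.TTheory GRing.Theory Num.Theory.
Local Open Scope ring_scope.

(** Singular values of a square matrix [M]: the square roots of the eigenvalues
    of [M^T M], repeated according to their multiplicity as roots of the
    characteristic polynomial, in non-increasing order. *)
Definition singular_values (R : realType) (m : nat) (M : 'M[R]_m) : seq R :=
  let P := char_poly (M^T *m M) in
  sort >=%R (map Num.sqrt
    (flatten [seq nseq (mup x P) x | x <- rootsR P])).

(** [sigma i M] is the i-th largest singular value, with [i] counted from 1. *)
Definition sigma (R : realType) (m : nat) (i : nat) (M : 'M[R]_m) : R :=
  (singular_values M)`_i.-1.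

Definition norm2 (R : realType) (k : nat) (v : 'cV[R]_k) : R :=
  Num.sqrt (\sum_(a < k) v a 0 ^+ 2).

Section RandBSQR.

Variables (R : realType) (m n : nat).
Variables (A : 'M[R]_(m, n)) (kb : nat) (g : 'I_n -> R).

Definition selected_cols (C : seq 'I_n) : 'M[R]_(m, size C) :=
  colsub (tnth (in_tuple C)) A.

(** For [i <= m] and [T : 'M_i], [pid_mx i *m T : 'M_(m, i)] is the block
    matrix [T; 0], and for [x : 'cV_m], [pid_mx i *m x : 'cV_i] is x(1:i).
    [is_trig_mx] means lower triangular. *)
Definition is_QR (C : seq 'I_n) (Q : 'M[R]_m) (T : 'M[R]_(size C)) : Prop :=
  [/\ Q^T *m Q = 1%:M, is_trig_mx T^T &
      selected_cols C = Q *m (pid_mx (size C) *m T)].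

Definition wvec (C : seq 'I_n) (Q : 'M[R]_m) (T : 'M[R]_(size C)) (j : 'I_n)
    : 'cV[R]_(size C) :=
  invmx T *m (pid_mx (size C) *m (Q^T *m col j A)).

Definition rho (C : seq 'I_n) (Q : 'M[R]_m) (j : 'I_n) : R :=
  Num.sqrt (\sum_(a < m | (size C <= a)%N) (Q^T *m col j A) a 0 ^+ 2).

Definition cost (C : seq 'I_n) (Q : 'M[R]_m) (T : 'M[R]_(size C)) (j : 'I_n)
    : R :=
  (1 + norm2 (wvec Q T j) ^+ 2) / rho C Q j ^+ 2.

(** The possible outcomes [B] of drawing [min(kb, #|J|)] indices from [J]
    one after the other, without replacement, with probabilities proportional
    to the weights [g]: an index of weight 0 can be drawn only once the indices
    of positive weight are exhausted. *)
Definition sample_outcome (J B : {set 'I_n}) : Prop :=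
  [/\ B \subset J, #|B| = minn kb #|J| &
      forall j k, j \in B -> g j = 0 -> k \in J -> 0 < g k -> k \in B].

Definition threshold (i : nat) (f : R) : R :=
  (m%:R - i%:R + 1) / (m%:R - i%:R) * f + (n%:R - 2 * i%:R) / (m%:R - i%:R).

Definition best_candidate (C : seq 'I_n) (Q : 'M[R]_m) (T : 'M[R]_(size C))
    (S : {set 'I_n}) (l : 'I_n) : Prop :=
  [/\ l \in S, 0 < rho C Q l &
      forall j, j \in S -> 0 < rho C Q j -> cost Q T l <= cost Q T j].

(** Control states.  The number of selected columns is [size C].
    - [Test C f]: about to test [|C| < m];
    - [Draw C f J]: about to sample a block from [J], no column having been
      selected since [J] was last initialized to the complement of [C];
    - [Select C f J B S sel]: inside the selection loop for the block [B], with
      remaining candidates [S]; [sel] tells whether a column has been selected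
      since [J] was last initialized. *)
Inductive state : Type :=
  | Test of seq 'I_n & R
  | Draw of seq 'I_n & R & {set 'I_n}
  | Select of seq 'I_n & R & {set 'I_n} & {set 'I_n} & {set 'I_n} & bool.

Definition after_select (sel : bool) (C : seq 'I_n) (f : R) (J : {set 'I_n})
    : state :=
  if sel then Test C f else Draw C f J.

Inductive step : state -> state -> Prop :=
  | step_start C f :
      (size C < m)%N ->
      step (Test C f) (Draw C f (~: [set j in C]))
  | step_discard C f J B Q T :
      sample_outcome J B -> @is_QR C Q T ->
      (forall j, j \in B -> rho C Q j = 0) ->
      step (Draw C f J) (Draw C f (J :\: B))
  | step_block C f J B Q T :
      sample_outcome J B -> @is_QR C Q T ->
      ~ (forall j, j \in B -> rho C Q j = 0) ->
      step (Draw C f J) (Select C f J B B false)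
  | step_accept C f J B (S : {set 'I_n}) sel Q T l :
      (size C < m)%N -> @is_QR C Q T -> best_candidate Q T S l ->
      ~~ (f + cost Q T l > threshold (size C) f) ->
      step (Select C f J B S sel)
           (Select (rcons C l) (f + cost Q T l) J B (S :\ l) true)
  | step_reject C f J B (S : {set 'I_n}) sel Q T l :
      (size C < m)%N -> @is_QR C Q T -> best_candidate Q T S l ->
      f + cost Q T l > threshold (size C) f ->
      step (Select C f J B S sel) (after_select sel C f (J :\: B))
  | step_exit C f J B (S : {set 'I_n}) sel Q T :
      @is_QR C Q T ->
      ~ ((size C < m)%N /\ exists2 j, j \in S & 0 < rho C Q j) ->
      step (Select C f J B S sel) (after_select sel C f J).

Definition init : state := Test [::] 0.

Inductive reachable : state -> Prop :=
  | reachable_init : reachable init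
  | reachable_step s t : reachable s -> step s t -> reachable t.

(** [C] is returned by some execution. *)
Definition randBSQR_returns (C : seq 'I_n) : Prop :=
  size C = m /\ exists f, reachable (Test C f).

(** Every execution from the given state returns after finitely many steps;
    in particular none gets stuck before. *)
Inductive always_returns : state -> Prop :=
  | always_returns_done C f : size C = m -> always_returns (Test C f)
  | always_returns_next s :
      (exists t, step s t) -> (forall t, step s t -> always_returns t) ->
      always_returns s.

Definition randBSQR_terminates : Prop := always_returns init.

End RandBSQR.

(* Main.v *)
Require Import Defs.
From HB Require Import structures.
From mathcomp Require Import all_boot all_order all_algebra.
From mathcomp Require Import reals polyrcf.
From mathcomp Require Import complex spectral sesquilinear ring lra.

(** Write [A = Z^T], so that [A A^T = 1], let [M_k] be the matrix of the first
    [k] selected columns and [G_k = M_k^T M_k] its Gram matrix.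

    Everything the algorithm computes is independent of the choice of the QR
    factorization: [w_j] is the least-squares solution [G^-1 M^T a_j], [rho_j]
    is the norm of the residual [a_j - M w_j] ([lsq_QR], [sqn_resid_QR]), and by
    the block inverse formula the cost of [j] is the increase of [tr G^-1] when
    [a_j] is appended to [M] ([gram_row_mx]).  Hence [f = tr G_k^-1] throughout.

    Termination.  Since [A A^T = 1], with [i] columns selected one has
    [\sum_(j \notin C) rho_j^2 = m - i] and
    [\sum_(j \notin C) (1 + |w_j|^2) = n - 2i + f].  So some unselected [j] has
    [rho_j > 0] and cost at most the ratio of these sums, which is exactly the
    acceptance condition ([exists_acceptable]).  A block that is
    discarded, or rejected before any selection, never contains such a column:
    all its residuals vanish, or its best candidate already fails the test.  So
    this column stays in the pool, the pool shrinks at each failure, and a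
    column is selected after finitely many blocks ([draw_returns]).

    Bound.  The acceptance test makes [f_i <= i (n - i + 1) / (m - i + 1)
    = i - 1 + L_i], where [L_i = 1 + i (n - m) / (m - i + 1)], because this
    expression solves the recurrence of the threshold with equality
    ([selection_inv_rcons]).  The eigenvalues of [G_i] lie in ]0, 1], so in the
    trace of [G_i^-1] each of the [i] terms is at least 1 and hence at most
    [L_i]: [G_i >= L_i^-1] ([contraction_trace_bound]).  As [G_i] is a
    compression of [G_m] to an [i]-dimensional space, [G_m] has at least [i]
    eigenvalues [>= L_i^-1] ([count_eigenvalues_ge]), that is,
    [sigma_i^2 >= L_i^-1]. *)

Set Implicit Arguments.
Unset Strict Implicit.
Unset Printing Implicit Defensive.

Import Order.TTheory GRing.Theory Num.Theory.
Local Open Scope ring_scope.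

(** * Householder reflections and QR factorization *)

Section RealLinearAlgebra.

Variable R : rcfType.

(** The squared Euclidean norm of a column vector. *)
Definition sqn (k : nat) (v : 'cV[R]_k) : R := \sum_(a < k) v a 0 ^+ 2.

Lemma sqn_tr k (v : 'cV[R]_k) : v^T *m v = (sqn v)%:M.
Proof.
apply/matrixP=> a b; rewrite !ord1 !mxE eqxx mulr1n.
by apply: eq_bigr => j _; rewrite mxE expr2.
Qed.

Lemma sqnE k (v : 'cV[R]_k) : sqn v = (v^T *m v) 0 0.
Proof. by rewrite sqn_tr mxE eqxx mulr1n. Qed.

Lemma sqn_ge0 k (v : 'cV[R]_k) : 0 <= sqn v.
Proof. by apply: sumr_ge0 => a _; rewrite sqr_ge0. Qed.

Lemma sqn_eq0 k (v : 'cV[R]_k) : (sqn v == 0) = (v == 0).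
Proof.
apply/eqP/eqP => [/eqP|->]; last first.
  by rewrite /sqn big1 // => a _; rewrite mxE expr0n.
rewrite psumr_eq0 => [|a _]; last by rewrite sqr_ge0.
move=> /allP h; apply/colP => a; rewrite mxE.
by have /= := h a (mem_index_enum a); rewrite sqrf_eq0 => /eqP.
Qed.

Lemma sqn_gt0 k (v : 'cV[R]_k) : (0 < sqn v) = (v != 0).
Proof. by rewrite lt0r sqn_eq0 sqn_ge0 andbT. Qed.

Lemma sqn_orth k l (Q : 'M[R]_(l, k)) (v : 'cV[R]_k) :
  Q^T *m Q = 1%:M -> sqn (Q *m v) = sqn v.
Proof.
by move=> hQ; rewrite !sqnE trmx_mul -mulmxA [Q^T *m _]mulmxA hQ mul1mx.
Qed.

Lemma sqn_col_mx k l (u : 'cV[R]_k) (v : 'cV[R]_l) :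
  sqn (col_mx u v) = sqn u + sqn v.
Proof. by rewrite !sqnE tr_col_mx mul_row_col mxE. Qed.

Lemma sqnBZ k (u v : 'cV[R]_k) c :
  sqn (u - c *: v) = sqn u - 2 * c * (v^T *m u) 0 0 + c ^+ 2 * sqn v.
Proof.
rewrite /sqn mxE !mulr_sumr -sumrB -big_split /=.
by apply: eq_bigr => a _; rewrite !mxE; ring.
Qed.

(** The reflection exchanging [v] and [|v| e_0], or the identity if they are
    equal. *)
Lemma householder k (v : 'cV[R]_(1 + k)) :
  exists2 H : 'M[R]_(1 + k), H^T *m H = 1%:M &
    H *m v = col_mx (Num.sqrt (sqn v))%:M 0.
Proof.
set al := Num.sqrt (sqn v); set e : 'cV[R]_(1 + k) := col_mx 1%:M 0.
have alE : col_mx al%:M 0 = al *: e.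
  by rewrite scale_col_mx scaler0 scalemx1.
have al2 : al ^+ 2 = sqn v by rewrite sqr_sqrtr ?sqn_ge0.
rewrite alE; set u := v - al *: e.
have [u0|un0] := eqVneq u 0.
  exists 1%:M; first by rewrite trmx1 mul1mx.
  by rewrite mul1mx; apply/eqP; rewrite -subr_eq0 -/u u0.
have q0 : sqn u != 0 by rewrite sqn_eq0.
have qe : sqn e = 1.
  by rewrite sqn_col_mx !sqnE trmx1 mulmx1 mulmx0 !mxE eqxx addr0.
(* [u] is the normal vector of the mirror, and [u^T v] is half of [|u|^2]. *)
have uu : sqn u = 2 * (sqn v - al * (e^T *m v) 0 0).
  by rewrite sqnBZ qe al2; ring.
have uv : u^T *m v = (sqn u / 2)%:M.
  rewrite [LHS]mx11_scalar; congr _%:M.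
  rewrite uu /u linearB /= linearZ /= mulmxBl -scalemxAl.
  by rewrite [LHS]mxE [X in _ + X]mxE [X in _ - X]mxE -sqnE; field.
pose H := 1%:M - (2 / sqn u) *: (u *m u^T).
exists H; last first.
  rewrite /H mulmxBl mul1mx -scalemxAl -mulmxA uv mul_mx_scalar scalerA.
  have -> : 2 / sqn u * (sqn u / 2) = 1 by field.
  by rewrite scale1r /u opprB addrC subrK.
have HT : H^T = H.
  by rewrite /H linearB linearZ /= trmx1 trmx_mul trmxK.
rewrite HT {1}/H mulmxBl mul1mx -scalemxAl /H mulmxBr mulmx1 -scalemxAr.
rewrite mulmxA -[u *m u^T *m u]mulmxA sqn_tr mul_mx_scalar -scalemxAl !scalerBr.
rewrite !scalerA.
rewrite -scalerBl -addrA -opprD -scalerDl.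
have -> : 2 / sqn u + (2 / sqn u - 2 / sqn u * (2 / sqn u * sqn u)) = 0.
  by field.
by rewrite scale0r subr0.
Qed.

(** A reflection clears the first column below its first entry; recurse on the
    remaining block. *)
Lemma QR_exists k m (M : 'M[R]_(m, k)) : (k <= m)%N ->
  exists Q : 'M[R]_m, exists T : 'M[R]_k,
    [/\ Q^T *m Q = 1%:M, is_trig_mx T^T & M = Q *m (pid_mx k *m T)].
Proof.
elim: k m M => [|k IH] m M.
  move=> _; exists 1%:M, 0; split; first by rewrite trmx1 mul1mx.
    by apply/is_trig_mxP => -[].
  by apply/matrixP => i [].
case: m M => // m; rewrite -[k.+1]/(1 + k)%N -[m.+1]/(1 + m)%N => M km.
have [H HH Hc] := householder (lsubmx M).
set N := H *m rsubmx M.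
have [Q [T [hQ hT E]]] := IH m (dsubmx N) km.
pose a := Num.sqrt (sqn (lsubmx M)).
have HM : H *m M = block_mx a%:M (usubmx N) 0 (Q *m (pid_mx k *m T)).
  by rewrite -E block_mxEh vsubmxK -Hc -mul_mx_row hsubmxK.
exists (H^T *m block_mx 1%:M 0 0 Q), (block_mx a%:M (usubmx N) 0 T); split.
- rewrite trmx_mul trmxK mulmxA -[_ *m H *m _]mulmxA (mulmx1C HH) mulmx1.
  rewrite tr_block_mx mulmx_block !trmx0 trmx1 !mulmx0 !mul0mx !addr0 !add0r.
  by rewrite mulmx1 hQ -scalar_mx_block.
- rewrite tr_block_mx is_trig_block_mx // hT trmx0 eqxx /=.
  by rewrite tr_scalar_mx scalar_mx_is_trig.
have -> : pid_mx (1 + k) = block_mx 1%:M 0 0 (pid_mx k) :> 'M[R]_(1 + m, 1 + k).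
  apply/matrixP => i j; rewrite -(splitK i) -(splitK j).
  case: (split i) (split j) => i' [] j' /=;
    rewrite ?block_mxEul ?block_mxEur ?block_mxEdl ?block_mxEdr !mxE ?ord1 //=.
rewrite -mulmxA !mulmx_block !mulmx0 !mul0mx !mul1mx !addr0 !add0r !mulmx0.
by rewrite -HM mulmxA HH mul1mx.
Qed.

End RealLinearAlgebra.

(** * Spectral theory of real symmetric matrices *)

(** Over the complex extension the matrix is Hermitian, so that its spectral
    decomposition has real eigenvalues, and these are roots of the real
    characteristic polynomial. *)
Lemma sym_eigenvalue (R : rcfType) n (A : 'M[R]_n.+1) :
  A^T = A -> exists x, eigenvalue A x.
Proof.
move=> As; pose B := map_mx (real_complex R) A.
have Bh : B \is hermsymmx.
  apply: realsym_hermsym.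
    by rewrite qualifE /= expr0 scale1r map_mx_id // /B map_trmx As.
  by apply/mxOverP => i j; apply/complex_realP; exists (A i j); rewrite mxE.
have /mxOverP /(_ 0 0)/complex_realP[x xE] := hermitian_spectral_diag_real Bh.
have /orthomx_spectralP E := hermitian_normalmx Bh.
exists x; suff: eigenvalue B (real_complex R x).
  rewrite !eigenvalue_root_char -[char_poly B]map_char_poly.
  by rewrite fmorph_root.
apply/eigenvalueP; exists (row 0 (spectralmx B)).
  rewrite -row_mul {2}E !mulmxA mulmxV ?spectral_unit // mul1mx.
  by rewrite row_mul row_diag_mx -scalemxAl -rowE xE.
apply/eqP => r0.
have /rowP/(_ 0) : delta_mx 0 0 = 0 :> 'rV[complex R]_n.+1.
  by rewrite -(mulmxK (spectral_unit B) (delta_mx 0 0)) -rowE r0 mul0mx.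
by rewrite !mxE !eqxx => /eqP; rewrite oner_eq0.
Qed.

(** Deflation: a reflection sending an eigenvector to a multiple of [e_0]
    splits off a 1 x 1 block. *)
Lemma real_spectral (R : rcfType) n (A : 'M[R]_n) : A^T = A ->
  exists2 U : 'M[R]_n, U^T *m U = 1%:M &
    exists d : 'rV[R]_n, A = U^T *m diag_mx d *m U.
Proof.
elim: n A => [|n IH] A As.
  by exists 1%:M; [rewrite trmx1 mul1mx | exists 0; apply/matrixP => -[]].
move: A As; rewrite -[n.+1]/(1 + n)%N => A As.
have [x /eigenvalueP[u ux u0]] := sym_eigenvalue As.
have [H HH] := householder (u^T : 'cV_(1 + n)).
set al := Num.sqrt _ => Hv.
have al0 : al != 0 by rewrite sqrtr_eq0 -ltNge sqn_gt0 -trmx0 (inj_eq trmx_inj).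
pose B : 'M_(1 + n) := H *m A *m H^T.
have Bs : B^T = B by rewrite !trmx_mul trmxK As mulmxA.
pose e : 'cV[R]_(1 + n) := col_mx 1%:M 0.
have Hv' : H *m u^T = al *: e by rewrite Hv scale_col_mx scaler0 scalemx1.
have Au : A *m u^T = x *: u^T by rewrite -{1}As -trmx_mul ux linearZ.
have Be : B *m e = x *: e.
  apply: (scalerI al0); rewrite scalemxAr -Hv' -mulmxA [H^T *m _]mulmxA HH mul1mx.
  by rewrite -mulmxA Au -scalemxAr Hv' !scalerA mulrC.
have BE : B = block_mx x%:M 0 0 (drsubmx B).
  move: Be; rewrite -{1}[B]submxK mul_block_col !mulmx1 !mulmx0 !addr0.
  rewrite scale_col_mx scaler0 scalemx1 => /eq_col_mx[e1 e2].
  rewrite -{1}[B]submxK e1 e2; congr block_mx.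
  by rewrite -[ursubmx B]trmxK trmx_ursub Bs e2 trmx0.
have [U UU [d dE]] := IH (drsubmx B) (etrans (trmx_drsub _) (congr1 _ Bs)).
exists (block_mx 1%:M 0 0 U *m H).
  rewrite trmx_mul -mulmxA [_^T *m (_ *m H)]mulmxA.
  rewrite tr_block_mx mulmx_block !trmx0 trmx1 !mulmx0 !mul0mx !addr0 !add0r.
  by rewrite mulmx1 UU -scalar_mx_block mul1mx.
exists (row_mx x%:M d).
have -> : A = H^T *m B *m H.
  by rewrite !mulmxA HH mul1mx -mulmxA HH mulmx1.
rewrite BE dE trmx_mul tr_block_mx !trmx0 trmx1 !mulmxA; congr (_ *m _).
rewrite -!mulmxA; congr (_ *m _).
rewrite diag_mx_row !mulmx_block !mulmx0 !mul0mx !mul1mx !addr0 !add0r !mulmx1.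
rewrite !mulmx0 !mulmxA; congr block_mx.
by apply/matrixP=> i j; rewrite !ord1 !mxE eqxx.
Qed.

Section Spectrum.

Variable R : rcfType.

Lemma spectral_quad k m (M : 'M[R]_(m, k)) (U : 'M[R]_k) (d : 'rV[R]_k) x :
  M^T *m M = U^T *m diag_mx d *m U ->
  sqn (M *m x) = \sum_j d 0 j * (U *m x) j 0 ^+ 2.
Proof.
move=> E; rewrite sqnE trmx_mul -mulmxA [M^T *m _]mulmxA E.
rewrite -!mulmxA [x^T *m _]mulmxA -trmx_mul mul_diag_mx mxE.
by apply: eq_bigr => j _; rewrite !mxE; ring.
Qed.

(** If [M^T M <= 1], each of the [k] terms [1 / d_j] of [tr (M^T M)^-1] is at
    least 1, so none of them exceeds the trace minus [k - 1]. *)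
Lemma contraction_trace_bound k m (M : 'M[R]_(m, k)) (L : R) :
  (forall x, sqn (M *m x) <= sqn x) -> M^T *m M \in unitmx ->
  \tr (invmx (M^T *m M)) <= k%:R - 1 + L ->
  forall x, sqn x <= L * sqn (M *m x).
Proof.
move=> Mle Gu tL x; set G := M^T *m M.
have Gs : G^T = G by rewrite trmx_mul trmxK.
have [U UU [d dE]] := real_spectral Gs.
have UU' := mulmx1C UU.
pose v j : 'cV[R]_k := U^T *m delta_mx j 0.
have Uv j : U *m v j = delta_mx j 0 by rewrite mulmxA UU' mul1mx.
have qv j : sqn (v j) = 1.
  rewrite -(sqn_orth _ UU) Uv /sqn (bigD1 j) //= big1 => [|a /negPf aj].
    by rewrite mxE !eqxx expr1n addr0.
  by rewrite mxE aj expr0n.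
have qMv j : sqn (M *m v j) = d 0 j.
  rewrite (spectral_quad _ dE) Uv (bigD1 j) //= big1 => [|a /negPf aj].
    by rewrite mxE !eqxx expr1n addr0 mulr1.
  by rewrite mxE aj expr0n mulr0.
have d_gt0 j : 0 < d 0 j.
  rewrite -qMv sqn_gt0; apply/eqP => Mv0.
  have : sqn (v j) = 0.
    by rewrite -(mulKmx Gu (v j)) -mulmxA Mv0 !mulmx0; apply/eqP; rewrite sqn_eq0.
  by move/eqP; rewrite qv oner_eq0.
have d_le1 j : d 0 j <= 1 by rewrite -qMv -(qv j).
pose d' : 'rV[R]_k := \row_j (d 0 j)^-1.
have invG : invmx G = U^T *m diag_mx d' *m U.
  have GV : G *m (U^T *m diag_mx d' *m U) = 1%:M.
    rewrite dE !mulmxA -[_ *m U *m U^T]mulmxA UU' mulmx1.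
    rewrite -[_ *m diag_mx d *m _]mulmxA mulmx_diag.
    suff -> : \row_j (d 0 j * d' 0 j) = const_mx 1.
      by rewrite diag_const_mx mulmx1.
    by apply/rowP => j; rewrite !mxE divff // gt_eqF.
  by rewrite -[RHS](mulKmx Gu) GV mulmx1.
have trE : \tr (invmx G) = \sum_j (d 0 j)^-1.
  rewrite invG -mulmxA mxtrace_mulC -mulmxA UU' mulmx1 mxtrace_diag.
  by apply: eq_bigr => j _; rewrite mxE.
have dL j : 1 <= L * d 0 j.
  rewrite -ler_pdivrMr // mul1r.
  have : k%:R - 1 <= \sum_(a | a != j) (d 0 a)^-1.
    apply: (@le_trans _ _ (\sum_(a | a != j) 1)); last first.
      by apply: ler_sum => a _; rewrite invf_ge1.
    have : \sum_(a < k) (1 : R) = k%:R by rewrite sumr_const card_ord.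
    by rewrite (bigD1 j) //= => <-; rewrite [leLHS]addrC addKr.
  by move: tL; rewrite trE (bigD1 j) //=; lra.
rewrite (spectral_quad x dE) -(sqn_orth x UU) mulr_sumr.
apply: ler_sum => j _; rewrite mulrA -[leLHS]mul1r.
by apply: ler_wpM2r => //; rewrite sqr_ge0.
Qed.

(** Half of the Courant-Fischer principle: if the quadratic form of [M^T M] is
    at least [lam] on the range of the isometry [E], of dimension [k], then
    [M^T M] has at least [k] eigenvalues [>= lam].  Otherwise that range would
    contain a nonzero vector orthogonal to all the eigenvectors for these
    eigenvalues. *)
Lemma count_eigenvalues_ge m p k (M : 'M[R]_(p, m)) (U : 'M[R]_m)
    (d : 'rV[R]_m) (E : 'M[R]_(m, k)) (lam : R) :
  U^T *m U = 1%:M -> M^T *m M = U^T *m diag_mx d *m U ->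
  E^T *m E = 1%:M ->
  (forall x, lam * sqn x <= sqn (M *m (E *m x))) ->
  (k <= #|[set j | (lam <= d ord0 j)%R]|)%N.
Proof.
move=> UU dE EE lamP; set K := [set j | _]; rewrite leqNgt; apply/negP => ltKk.
(* [N] computes the coordinates of [E x] along the eigenvectors in [K]; it has
   fewer rows than columns, hence a nontrivial kernel. *)
pose N : 'M[R]_(#|K|, k) := rowsub enum_val (U *m E).
have : kermx N^T != 0.
  rewrite kermx_eq0; apply/negP => /eqP rk.
  by have := rank_leq_col N^T; rewrite rk leqNgt ltKk.
case/rowV0Pn => u /sub_kermxP uN u0.
pose x := u^T.
have xn0 : x != 0 by rewrite -trmx0 (inj_eq trmx_inj).
have Nx : N *m x = 0 by rewrite -[N]trmxK -trmx_mul uN trmx0.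
set y := U *m (E *m x).
have yK j : lam <= d 0 j -> y j 0 = 0.
  move=> jK; have jK' : j \in K by rewrite inE.
  have /colP/(_ (enum_rank_in jK' j)) := Nx.
  by rewrite /N mul_rowsub_mx -mulmxA -/y mxE enum_rankK_in // => ->; rewrite mxE.
have sy : sqn y = sqn x by rewrite !sqn_orth.
have := lamP x; rewrite (spectral_quad _ dE) -/y -sy /sqn mulr_sumr.
apply/negP; rewrite -ltNge.
have le1 j : d 0 j * y j 0 ^+ 2 <= lam * y j 0 ^+ 2.
  have [/yK ->|/ltW] := lerP lam (d 0 j); first by rewrite expr0n !mulr0.
  by move=> ?; rewrite ler_wpM2r ?sqr_ge0.
have : y != 0 by rewrite -sqn_eq0 sy sqn_eq0.
case/cV0Pn => j yj.
rewrite (bigD1 j) //= [ltRHS](bigD1 j) //=.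
apply: ltr_leD; last by apply: ler_sum.
rewrite ltr_pM2r ?exprn_even_gt0 //.
by rewrite ltNge; apply/negP => /yK /eqP; apply/negP.
Qed.

(** A split polynomial is recovered from its real roots and their
    multiplicities. *)
Lemma perm_rootsR (ds : seq R) (P := \prod_(x <- ds) ('X - x%:P)) :
  perm_eq (flatten [seq nseq (mup x P) x | x <- rootsR P]) ds.
Proof.
have P0 : P != 0 by rewrite monic_neq0 // monic_prod_XsubC.
apply/allP => y _ /=; rewrite count_flatten -map_comp.
rewrite -(mu_prod_XsubC y ds) -/P; apply/eqP.
rewrite sumnE big_map.
under eq_bigr => x _ do rewrite /= count_nseq /=.
have [yr|yr] := boolP (y \in rootsR P).
  rewrite (bigD1_seq y) //= ?uniq_roots // eqxx mul1n big1 ?addn0 // => x /negPf.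
  by rewrite eq_sym => ->.
rewrite big1_seq => [|x /= xr]; last first.
  by case: eqP => // xy; rewrite -xy xr in yr.
rewrite mupNroot //; apply: contra yr => yr.
have := roots_on_rootsR P0 y; rewrite inE /= => <-.
by rewrite yr.
Qed.

Lemma nth_sorted_ge (s : seq R) (mu : R) i :
  sorted >=%R s -> (0 < i)%N -> (i <= count (>= mu)%R s)%N -> mu <= s`_i.-1.
Proof.
move=> ss i0 ic; rewrite leNgt; apply/negP => lt.
have : (count (>= mu)%R s <= i.-1)%N.
  rewrite -{1}(cat_take_drop i.-1 s) count_cat.
  have -> : count (>= mu)%R (drop i.-1 s) = 0%N.
    apply/eqP; rewrite -leqn0 leqNgt -has_count; apply/hasPn => x /(nthP 0)[j].
    rewrite size_drop nth_drop ltn_subRL => jl <-; rewrite -ltNge.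
    apply: le_lt_trans lt.
    apply: (sorted_leq_nth ge_trans ge_refl 0 ss) (leq_addr _ _) => //.
    exact: leq_ltn_trans (leq_addr _ _) jl.
  by rewrite addn0 (leq_trans (count_size _ _)) // size_take_min geq_minl.
by move=> /(leq_trans ic); rewrite leqNgt prednK // leqnn.
Qed.

End Spectrum.

Lemma char_poly_similar (R : fieldType) n (P A B : 'M[R]_n) :
  P \in unitmx -> P *m A = B *m P -> char_poly A = char_poly B.
Proof.
move=> Pu PAB; pose Q := map_mx polyC P.
have : \det Q != 0 by rewrite det_map_mx polyC_eq0 -unitfE -unitmxE.
move/mulfI; apply; rewrite [RHS]mulrC -!det_mulmx; congr (\det _).
rewrite /char_poly_mx mulmxBl mulmxBr -!map_mxM PAB.
by rewrite scalar_mxC.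
Qed.

(** The hypothesis is on [M M^T], which for an invertible [M] is similar to the
    matrix [M^T M] defining the singular values. *)
Lemma sigma_ge (R : realType) m i (M : 'M[R]_m) (E : 'M[R]_(m, i)) (lam : R) :
  M \in unitmx -> E^T *m E = 1%:M -> (0 < i)%N -> 
  (forall x, lam * sqn x <= sqn (M^T *m (E *m x))) ->
  Num.sqrt lam <= sigma i M.
Proof.
move=> Mu EE i0 h.
have Gs : (M *m M^T)^T = M *m M^T by rewrite trmx_mul trmxK.
have [U UU [d dE]] := real_spectral Gs.
have cnt : (i <= #|[set j | (lam <= d ord0 j)%R]|)%N.
  by apply: (count_eigenvalues_ge UU _ EE h); rewrite trmxK.
have cp : char_poly (M^T *m M) = \prod_(x <- [seq d 0 j | j : 'I_m]) ('X - x%:P).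
  rewrite (char_poly_similar Mu (mulmxA _ _ _)).
  have Uu : U \in unitmx by case/mulmx1_unit: UU.
  rewrite (@char_poly_similar _ _ U _ (diag_mx d)) //; last first.
    by rewrite dE !mulmxA (mulmx1C UU) mul1mx.
  rewrite char_poly_trig ?diag_mx_is_trig // big_map big_enum.
  by apply: eq_bigr => j _; rewrite mxE eqxx.
rewrite /sigma /singular_values cp.
apply: nth_sorted_ge => //; first by apply: sort_sorted => x y; rewrite le_total.
rewrite count_sort.
have /permP -> := perm_map Num.sqrt (perm_rootsR [seq d 0 j | j : 'I_m]).
rewrite -map_comp count_map (leq_trans cnt) //.
rewrite cardE size_filter enumT; apply: sub_count => j /=.
by rewrite inE => /ler_wsqrtr.
Qed.

(** * Least squares and Gram matrices *)

Section LeastSquares.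

Variables (R : rcfType) (m k : nat) (M : 'M[R]_(m, k)).

(** The Gram matrix of the columns of [M]. *)
Definition gram : 'M[R]_k := M^T *m M.

(** The least-squares solution [x] of [M x = a], by the normal equations; it is
    meaningful when [gram] is invertible. *)
Definition lsq (a : 'cV[R]_m) : 'cV[R]_k := invmx gram *m (M^T *m a).

(** The component of [a] orthogonal to the column space of [M]. *)
Definition resid (a : 'cV[R]_m) : 'cV[R]_m := a - M *m lsq a.

(** The selection cost of [a], expressed without a QR factorization. *)
Definition lsq_cost (a : 'cV[R]_m) : R := (1 + sqn (lsq a)) / sqn (resid a).

Hypothesis Gu : gram \in unitmx.

Lemma gram_sym : gram^T = gram.
Proof. by rewrite trmx_mul trmxK. Qed.

Lemma invgram_sym : (invmx gram)^T = invmx gram.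
Proof. by rewrite trmx_inv gram_sym. Qed.

Lemma gram_lsq a : gram *m lsq a = M^T *m a.
Proof. by rewrite mulmxA mulmxV // mul1mx. Qed.

Lemma lsq_image v : lsq (M *m v) = v.
Proof. by rewrite /lsq [M^T *m _]mulmxA mulKmx. Qed.

Lemma resid_image v : resid (M *m v) = 0.
Proof. by rewrite /resid lsq_image subrr. Qed.

Lemma sqn_resid a : sqn (resid a) = sqn a - ((M^T *m a)^T *m lsq a) 0 0.
Proof.
have aM : M^T *m resid a = 0.
  by rewrite mulmxBr mulmxA gram_lsq subrr.
rewrite sqnE /resid [X in X *m _]linearB /= mulmxBl trmx_mul -mulmxA.
rewrite aM mulmx0 subr0.
by rewrite mulmxBr mxE [X in _ + X]mxE -sqnE trmx_mul trmxK mulmxA.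
Qed.

Section QR.

Variables (Q : 'M[R]_m) (T : 'M[R]_k).
Hypotheses (km : (k <= m)%N) (QQ : Q^T *m Q = 1%:M).
Hypothesis ME : M = Q *m (pid_mx k *m T).

Let pidK : (pid_mx k : 'M[R]_(k, m)) *m (pid_mx k : 'M[R]_(m, k)) = 1%:M.
Proof. by rewrite pid_mx_id // pid_mx_1. Qed.

Let gramT : gram = T^T *m T.
Proof.
rewrite /gram ME !trmx_mul tr_pid_mx -!mulmxA [Q^T *m _]mulmxA QQ mul1mx.
by rewrite [pid_mx k *m (_ *m _)]mulmxA pidK mul1mx.
Qed.

Let Tu : T \in unitmx.
Proof. by move: Gu; rewrite gramT unitmx_mul => /andP[]. Qed.

Lemma lsq_QR a : invmx T *m (pid_mx k *m (Q^T *m a)) = lsq a.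
Proof.
rewrite -[LHS](mulKmx Gu) {2}gramT -mulmxA (mulKVmx Tu) /lsq.
by rewrite ME !trmx_mul tr_pid_mx -!mulmxA.
Qed.

Lemma sqn_resid_QR a :
  \sum_(i < m | (k <= i)%N) (Q^T *m a) i 0 ^+ 2 = sqn (resid a).
Proof.
set x := Q^T *m a.
have QQ' := mulmx1C QQ.
rewrite -(@sqn_orth _ _ _ Q^T) ?trmxK //.
have -> : Q^T *m resid a = x - pid_mx k *m x.
  rewrite mulmxBr -lsq_QR {1}ME -/x -!mulmxA [Q^T *m _]mulmxA QQ mul1mx.
  by rewrite (mulKVmx Tu) mulmxA pid_mx_id.
rewrite big_mkcond; apply: eq_bigr => i _.
rewrite [in RHS]mxE [X in _ + X]mxE [X in _ - X]mxE.
rewrite (bigD1 i) //= big1 => [|j /negPf ji].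
  rewrite [pid_mx _ i i]mxE eqxx /= addr0 leqNgt.
  by case: ltnP => _; rewrite ?mul1r ?subrr ?expr0n // mul0r subr0.
by rewrite [pid_mx _ i j]mxE (inj_eq (@ord_inj m)) eq_sym ji mul0r.
Qed.

End QR.

(** The squared norm [s] of the residual is the Schur complement of [gram] in
    the bordered Gram matrix, whose inverse is the block matrix [X] below. *)
Lemma gram_row_mx a (M' := row_mx M a) : sqn (resid a) != 0 ->
  M'^T *m M' \in unitmx /\
  \tr (invmx (M'^T *m M')) = \tr (invmx gram) + lsq_cost a.
Proof.
set s := sqn _ => s0.
set w := lsq a; set b := M^T *m a.
have GE : M'^T *m M' = block_mx gram b b^T (sqn a)%:M.
  by rewrite tr_row_mx mul_col_row sqn_tr trmx_mul trmxK.
have bw : b^T *m w = (sqn a - s)%:M.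
  by rewrite /s sqn_resid [LHS]mx11_scalar opprB addrCA subrr addr0.
have bG : b^T *m invmx gram = w^T.
  by rewrite -[LHS]trmxK trmx_mul trmxK invgram_sym.
pose X := block_mx (invmx gram + s^-1 *: (w *m w^T)) (- s^-1 *: w)
            (- s^-1 *: w^T) (s^-1)%:M.
have GX : M'^T *m M' *m X = 1%:M.
  rewrite GE mulmx_block scalar_mx_block.
  have Gw : gram *m w = b by exact: gram_lsq.
  congr block_mx.
  - rewrite mulmxDr mulmxV // -!scalemxAr mulmxA Gw -addrA scaleNr subrr.
    by rewrite addr0.
  - by rewrite -scalemxAr Gw mul_mx_scalar scaleNr addNr.
  - rewrite mulmxDr bG -!scalemxAr mulmxA bw !mul_scalar_mx !scalerA.
    rewrite -[X in X + _ + _]scale1r -!scalerDl.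
    have -> : 1 + s^-1 * (sqn a - s) + - s^-1 * sqn a = 0 by field.
    by rewrite scale0r.
  - rewrite -scalemxAr bw scale_scalar_mx -scalar_mxM -raddfD /=.
    by congr _%:M; field.
have [Gu' _] := mulmx1_unit GX; split=> //.
rewrite -[invmx _]mulmx1 -GX mulKmx // mxtrace_block mxtraceD linearZ /=.
rewrite mxtrace_mulC sqn_tr !mxtrace_scalar !mulr1n /lsq_cost -/w -/s.
by field.
Qed.

End LeastSquares.

(** * Averages over the columns of a coisometry *)

Section Averaging.

Variables (R : rcfType) (m n k : nat) (A : 'M[R]_(m, n)) (M : 'M[R]_(m, k)).
Hypothesis AA : A *m A^T = 1%:M.

Lemma sum_sqn_col p (B : 'M[R]_(p, n)) :
  \sum_j sqn (col j B) = \tr (B *m B^T).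
Proof.
rewrite mxtrace_mulC; apply: eq_bigr => j _.
rewrite mxE; apply: eq_bigr => a _; by rewrite !mxE expr2.
Qed.

Hypothesis Gu : gram M \in unitmx.

Let W := invmx (gram M) *m (M^T *m A).

Let WA : W *m A^T = invmx (gram M) *m M^T.
Proof. by rewrite -!mulmxA AA mulmx1. Qed.

Let WW : W *m W^T = invmx (gram M).
Proof.
rewrite {2}/W trmx_mul mulmxA trmx_mul mulmxA WA trmxK invgram_sym.
by rewrite -[_ *m M^T *m M]mulmxA mulVmx // mul1mx.
Qed.

Lemma sum_sqn_lsq : \sum_j sqn (lsq M (col j A)) = \tr (invmx (gram M)).
Proof.
rewrite -WW -sum_sqn_col; apply: eq_bigr => j _.
by rewrite /lsq /W !colE !mulmxA.
Qed.

Lemma sum_sqn_resid : \sum_j sqn (resid M (col j A)) = m%:R - k%:R.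
Proof.
transitivity (\sum_j sqn (col j (A - M *m W))).
  by apply: eq_bigr => j _; rewrite /resid /lsq /W !colE mulmxBl !mulmxA.
rewrite sum_sqn_col linearB /= mulmxBl !mulmxBr AA trmx_mul.
have -> : M *m W *m (W^T *m M^T) = M *m (W *m A^T).
  by rewrite mulmxA -[M *m W *m _]mulmxA WW WA mulmxA.
have -> : A *m (W^T *m M^T) = (M *m (W *m A^T))^T.
  by rewrite [RHS]trmx_mul [(W *m _)^T]trmx_mul trmxK mulmxA.
rewrite -[M *m W *m A^T]mulmxA subrr subr0 raddfB /= mxtrace1 mxtrace_tr.
by rewrite WA mxtrace_mulC -mulmxA mulVmx // mxtrace1.
Qed.

Lemma sqn_coisometry (y : 'cV[R]_n) : sqn (A *m y) <= sqn y.
Proof.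
have E : sqn (y - A^T *m (A *m y)) = sqn y - sqn (A *m y).
  rewrite sqnE [X in X *m _]linearB /= mulmxBl !mulmxBr !trmx_mul trmxK.
  rewrite -!mulmxA [A *m (A^T *m _)]mulmxA AA mul1mx subrr subr0.
  by rewrite !sqnE trmx_mul -mulmxA mxE [X in _ + X]mxE.
by rewrite -subr_ge0 -E sqn_ge0.
Qed.

End Averaging.

(** * Quality of the selected columns *)

Section Selection.

Variables (R : realType) (m n : nat) (A : 'M[R]_(m, n)).

(** The first [k] selected columns, padded with zero columns when [size C < k].
    The width [k] is a separate argument so that [C] can vary without changing
    the type. *)
Definition prefix_cols (k : nat) (C : seq 'I_n) : 'M[R]_(m, k) :=
  \matrix_(a < m, i < k) (nth 0 [seq col j A | j <- C] i) a 0.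

Lemma prefix_colsE k (C : seq 'I_n) a (i : 'I_k) j0 : (k <= size C)%N ->
  prefix_cols k C a i = A a (nth j0 C i).
Proof.
by move=> kC; rewrite mxE (nth_map j0) ?mxE // (leq_trans _ kC).
Qed.

Lemma prefix_cols_rcons k (C : seq 'I_n) l : (k <= size C)%N ->
  prefix_cols k (rcons C l) = prefix_cols k C.
Proof.
move=> kC; apply/matrixP => a i; rewrite !mxE map_rcons nth_rcons size_map.
by rewrite (leq_trans _ kC).
Qed.

Lemma prefix_cols_last (C : seq 'I_n) l :
  prefix_cols (size C + 1) (rcons C l) = row_mx (prefix_cols (size C) C) (col l A).
Proof.
apply/matrixP => a i; rewrite -(splitK i); case: (split i) => j /=.
  by rewrite row_mxEl !mxE map_rcons nth_rcons size_map /= ltn_ord.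
by rewrite row_mxEr !mxE ord1 map_rcons nth_rcons size_map /= addn0 ltnn eqxx mxE.
Qed.

Lemma prefix_cols_pid i k C : (i <= k)%N ->
  prefix_cols k C *m (pid_mx i : 'M_(k, i)) = prefix_cols i C.
Proof.
move=> ik; apply/matrixP => a j; rewrite mxE.
rewrite (bigD1 (widen_ord ik j)) //= big1 => [|b /negPf bj].
  by rewrite !mxE /= eqxx ltn_ord mulr1 addr0.
rewrite [X in _ * X]mxE; case: eqP => [bj'|]; last by rewrite mulr0.
by case/eqP: bj; apply: val_inj.
Qed.

Lemma prefix_cols_delta (C : seq 'I_n) j : j \in C ->
  exists i : 'I_(size C), col j A = prefix_cols (size C) C *m delta_mx i 0.
Proof.
move=> jC; have ij : (index j C < size C)%N by rewrite index_mem.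
exists (Ordinal ij); rewrite -colE; apply/colP => a.
by rewrite !mxE (nth_map j) //= nth_index // mxE.
Qed.

Hypothesis AA : A *m A^T = 1%:M.

(** The selected columns are [A *m S] for the 0/1 matrix [S] of the selection,
    whose columns are orthonormal as [C] has no repetition. *)
Lemma prefix_cols_contraction k (C : seq 'I_n) x : uniq C -> (k <= size C)%N ->
  sqn (prefix_cols k C *m x) <= sqn x.
Proof.
move=> uC kC.
pose S : 'M[R]_(n, k) := \matrix_(j, i) (index j C == i)%:R.
have at_ (i : 'I_k) :
    exists j0 : 'I_n, forall j : 'I_n, (index j C == i) = (j == j0).
  have iC : (i < size C)%N by rewrite (leq_trans _ kC).
  exists (tnth (in_tuple C) (Ordinal iC)) => j.
  rewrite (tnth_nth j) /=; apply/eqP/eqP => [ji|->].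
    by rewrite -ji nth_index // -index_mem ji.
  by rewrite index_uniq.
have SS : S^T *m S = 1%:M.
  apply/matrixP => i i'; rewrite !mxE; have [j0 hj0] := at_ i.
  rewrite (bigD1 j0) //= big1 => [|j /negPf jj0].
    rewrite !mxE addr0 hj0 eqxx mul1r.
    have /eqP -> : index j0 C == i by rewrite hj0.
    by rewrite (inj_eq (@ord_inj _)).
  by rewrite !mxE hj0 jj0 mul0r.
have -> : prefix_cols k C = A *m S.
  apply/matrixP => a i; rewrite [RHS]mxE; have [j0 hj0] := at_ i.
  rewrite (bigD1 j0) //= big1 => [|j /negPf jj0].
    have /eqP ij : index j0 C == i by rewrite hj0.
    rewrite (prefix_colsE _ _ j0) // -ij nth_index //.
      by rewrite !mxE hj0 eqxx mulr1 addr0.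
    by rewrite -index_mem ij (leq_trans _ kC).
  by rewrite !mxE hj0 jj0 mulr0.
by rewrite -mulmxA (le_trans (sqn_coisometry AA _)) // sqn_orth.
Qed.

(** The averaging argument: if all unselected columns with nonzero residual
    cost more than [tau], the sum of [1 + |w_j|^2] over the unselected columns
    exceeds [tau] times that of [rho_j^2], contradicting the values of these
    sums. *)
Lemma exists_acceptable C (M := prefix_cols (size C) C) :
  uniq C -> (size C < m)%N -> gram M \in unitmx ->
  exists j, [/\ j \notin C, 0 < sqn (resid M (col j A)) &
    lsq_cost M (col j A) <=
      (n%:R - 2 * (size C)%:R + \tr (invmx (gram M))) / (m%:R - (size C)%:R)].
Proof.
move=> uC Cm Gu; set tau := _ / _.
have mC : 0 < m%:R - (size C)%:R :> R by rewrite subr_gt0 ltr_nat.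
pose ok j := [&& j \notin C, 0 < sqn (resid M (col j A))
  & lsq_cost M (col j A) <= tau].
case: (pickP ok) => [j /and3P[? ? ?]|nok]; first by exists j.
have image j : j \in C -> resid M (col j A) = 0 /\ sqn (lsq M (col j A)) = 1.
  case/(prefix_cols_delta) => i ->; rewrite resid_image // lsq_image //; split=> //.
  rewrite /sqn (bigD1 i) //= big1 => [|a /negPf ai].
    by rewrite mxE !eqxx expr1n addr0.
  by rewrite mxE ai expr0n.
have lt_tau j : j \notin C ->
    tau * sqn (resid M (col j A)) < 1 + sqn (lsq M (col j A)).
  move=> jC; have : 0 <= sqn (resid M (col j A)) by exact: sqn_ge0.
  rewrite le_eqVlt => /predU1P[<-|r0].
    by rewrite mulr0 ltr_wpDr ?sqn_ge0.
  have /negbT := nok j; rewrite /ok jC r0 /= -ltNge /lsq_cost.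
  by rewrite ltr_pdivlMr.
have sr : \sum_(j | j \notin C) sqn (resid M (col j A)) = m%:R - (size C)%:R.
  rewrite -(sum_sqn_resid AA Gu) [RHS](bigID (mem C)) /=.
  rewrite [X in _ = X + _]big1 ?add0r // => j jC.
  by rewrite (image j jC).1 /sqn big1 // => a _; rewrite mxE expr0n.
have cC : \sum_(j in C) (1 : R) = (size C)%:R.
  by rewrite sumr_const (card_uniqP uC).
have cN : \sum_(j | j \notin C) (1 : R) = n%:R - (size C)%:R.
  have : \sum_(j < n) (1 : R) = n%:R by rewrite sumr_const card_ord.
  by rewrite (bigID (mem C)) /= cC => <-; rewrite addrAC subrr add0r.
have sl : \sum_(j | j \notin C) (1 + sqn (lsq M (col j A))) =
    n%:R - 2 * (size C)%:R + \tr (invmx (gram M)).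
  rewrite big_split /= cN -(sum_sqn_lsq AA Gu) [in RHS](bigID (mem C)) /=.
  have -> : \sum_(j in C) sqn (lsq M (col j A)) = (size C)%:R.
    by rewrite -cC; apply: eq_bigr => j /image[].
  by ring.
have [j jC] : exists j : 'I_n, j \notin C.
  case: (pickP (fun j => j \notin C)) => [j|none]; first by exists j.
  by move: mC; rewrite -sr big_pred0 // ltxx.
have : \sum_(j | j \notin C) tau * sqn (resid M (col j A)) <
       \sum_(j | j \notin C) (1 + sqn (lsq M (col j A))).
  apply: ltr_sum; first by apply/hasP; exists j; rewrite ?mem_index_enum.
  by move=> a; exact: lt_tau.
by rewrite -mulr_sumr sr sl /tau divfK ?ltxx // gt_eqF.
Qed.

(** The bound on [tr G_i^-1] propagated by the acceptance test. *)
Definition trace_bound (i : nat) : R :=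
  i%:R * (n%:R - i%:R + 1) / (m%:R - i%:R + 1).

(** The invariant of the algorithm, for the selected columns [C] and the
    accumulated cost [f].  The trace bound is recorded for all prefixes of [C],
    since the i-th singular value is estimated from the first [i] columns. *)
Definition selection_inv (C : seq 'I_n) (f : R) : Prop :=
  [/\ (size C <= m)%N, uniq C,
      f = \tr (invmx (gram (prefix_cols (size C) C))) &
      forall k, (k <= size C)%N -> gram (prefix_cols k C) \in unitmx /\
        \tr (invmx (gram (prefix_cols k C))) <= trace_bound k].

Lemma selection_inv_nil : selection_inv [::] 0.
Proof.
split=> //; first by rewrite /mxtrace big_ord0.
move=> k; rewrite leqn0 => /eqP ->; rewrite unitmxE det_mx00 unitr1.
by split=> //; rewrite /mxtrace big_ord0 /trace_bound !mul0r.
Qed.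

Lemma selection_inv_rcons C f l (M := prefix_cols (size C) C) :
  selection_inv C f -> (size C < m)%N -> 0 < sqn (resid M (col l A)) ->
  f + lsq_cost M (col l A) <= threshold m n (size C) f ->
  selection_inv (rcons C l) (f + lsq_cost M (col l A)).
Proof.
move=> [_ uC fE Ck] Cm r0 le_thr.
have [Gu ft] := Ck _ (leqnn _); rewrite -/M -fE in Gu ft.
have lC : l \notin C.
  apply/negP => /prefix_cols_delta[i li]; move: r0.
  by rewrite li resid_image // sqn_gt0 eqxx.
have [Gu' trE] := gram_row_mx Gu (lt0r_neq0 r0).
rewrite -prefix_cols_last -fE in Gu' trE.
rewrite -/(gram _) in Gu' trE.
have fs : f + lsq_cost M (col l A) =
    \tr (invmx (gram (prefix_cols (size (rcons C l)) (rcons C l)))).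
  by rewrite size_rcons -addn1 trE.
split=> //; rewrite ?size_rcons ?rcons_uniq ?lC // => k.
rewrite leq_eqVlt => /predU1P[->|kC]; last first.
  by rewrite prefix_cols_rcons //; apply: Ck.
rewrite -addn1 trE; split=> //.
apply: (le_trans le_thr).
have mC : 0 < m%:R - (size C)%:R :> R by rewrite subr_gt0 ltr_nat.
have mC1 : 0 < m%:R - (size C)%:R + 1 :> R by rewrite addr_gt0.
(* The bound satisfies the recurrence of the threshold with equality. *)
have -> : trace_bound (size C + 1) = threshold m n (size C) (trace_bound (size C)).
  rewrite /trace_bound /threshold natrD; field.
  by rewrite !gt_eqF //=; lra.
rewrite /threshold lerD2r ler_wpM2l // divr_ge0 // ltW //.
Qed.

End Selection.

(** * Executions of the algorithm *)

Section Execution.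

Variables (R : realType) (m n : nat) (A : 'M[R]_(m, n)).
Variables (kb : nat) (g : 'I_n -> R).
Hypotheses (AA : A *m A^T = 1%:M) (kb_gt0 : (1 <= kb)%N).

Let step := @step R m n A kb g.
Let inv := selection_inv A.

Lemma selected_colsE (C : seq 'I_n) :
  selected_cols A C = prefix_cols A (size C) C.
Proof.
apply/matrixP => a i; rewrite [LHS]mxE.
rewrite (prefix_colsE _ _ _ (tnth (in_tuple C) i)) //; congr (A a _).
exact: tnth_nth.
Qed.

Lemma inv_unit C f : inv C f -> gram (prefix_cols A (size C) C) \in unitmx.
Proof. by case=> _ _ _ /(_ _ (leqnn _))[]. Qed.

Lemma inv_le C f : inv C f -> (size C <= m)%N.
Proof. by case. Qed.

Lemma rhoE C f Q (T : 'M[R]_(size C)) j : inv C f -> is_QR A Q T ->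
  rho A C Q j = Num.sqrt (sqn (resid (prefix_cols A (size C) C) (col j A))).
Proof.
move=> iC [QQ _ E]; rewrite selected_colsE in E.
by rewrite /rho (sqn_resid_QR (inv_unit iC) (inv_le iC) QQ E).
Qed.

Lemma costE C f Q (T : 'M[R]_(size C)) j : inv C f -> is_QR A Q T ->
  cost A Q T j = lsq_cost (prefix_cols A (size C) C) (col j A).
Proof.
move=> iC qr; rewrite /cost (rhoE j iC qr) /norm2 /wvec.
case: qr => QQ _ E; rewrite selected_colsE in E.
rewrite -/(sqn _) (lsq_QR (inv_unit iC) (inv_le iC) QQ E).
by rewrite !sqr_sqrtr ?sqn_ge0.
Qed.

Lemma is_QR_exists C f : inv C f -> exists Q, exists T, @is_QR R m n A C Q T.
Proof.
move=> /inv_le /(QR_exists (selected_cols A C))[Q [T [? ? ?]]].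
by exists Q, T; split.
Qed.

(** A block can always be drawn: take the indices of positive weight first. *)
Lemma sample_exists (J : {set 'I_n}) : exists B, sample_outcome kb g J B.
Proof.
pose P := [set k in J | 0 < g k].
pose s := enum P ++ enum (J :\: P).
have us : uniq s.
  rewrite cat_uniq !enum_uniq andbT; apply/hasPn => x.
  by rewrite !mem_enum inE => /andP[].
have sJ : s =i J.
  move=> x; rewrite mem_cat !mem_enum !inE; case: (x \in J); rewrite ?andbF //.
  by rewrite /= andbT orbN.
have szs : size s = #|J| by rewrite -(card_uniqP us); apply: eq_card.
exists [set x in take (minn kb #|J|) s]; split.
- by apply/subsetP => x; rewrite inE => /mem_take; rewrite sJ.
- rewrite cardsE (card_uniqP (take_uniq _ us)) size_takel // szs.
  exact: geq_minr.
move=> j k; rewrite !inE => jt gj kJ gk.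
have kP : k \in enum P by rewrite mem_enum inE kJ.
have jP : j \notin enum P by rewrite mem_enum inE gj ltxx andbF.
move: jt; rewrite take_cat; case: ltnP => [_ /mem_take|_ _].
  by rewrite (negPf jP).
by rewrite mem_cat kP.
Qed.

(** Only the selected columns and the accumulated cost are constrained. *)
Definition state_inv (s : state R n) : Prop :=
  match s with
  | Test C f | Draw C f _ | Select C f _ _ _ _ => inv C f
  end.

Lemma step_inv s t : state_inv s -> step s t -> state_inv t.
Proof.
move=> si st; case: st si => //=.
- move=> C f J B S sel Q T l Cm qr [_ + _] + iC.
  rewrite (rhoE _ iC qr) (costE _ iC qr) sqrtr_gt0 -leNgt => r0 le_thr.
  exact: selection_inv_rcons.
- by move=> C f J B S [] *.
- by move=> C f J B S [] *.
Qed.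

Lemma reachable_inv s : reachable A kb g s -> state_inv s.
Proof.
elim=> [|s' t _ IH st]; first exact: selection_inv_nil.
exact: step_inv IH st.
Qed.

(** The column [j] passes the acceptance test. *)
Definition acceptable (C : seq 'I_n) (f : R) (j : 'I_n) : Prop :=
  let M := prefix_cols A (size C) C in
  0 < sqn (resid M (col j A)) /\
  f + lsq_cost M (col j A) <= threshold m n (size C) f.

Lemma inv_acceptable C f : inv C f -> (size C < m)%N ->
  exists2 j, j \notin C & acceptable C f j.
Proof.
move=> iC Cm; have [_ uC fE _] := iC.
have [j [jC r0 le_c]] := exists_acceptable AA uC Cm (inv_unit iC).
exists j => //; split=> //; rewrite -fE in le_c.
apply: (le_trans (lerD (lexx f) le_c)).
have mC : 0 < m%:R - (size C)%:R :> R by rewrite subr_gt0 ltr_nat.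
rewrite /threshold le_eqVlt; apply/orP; left; apply/eqP; field.
by rewrite gt_eqF.
Qed.

Lemma best_exists C Q (T : 'M[R]_(size C)) (S : {set 'I_n}) j :
  j \in S -> 0 < rho A C Q j -> exists l, best_candidate A Q T S l.
Proof.
move=> jS rj; pose P := [pred x | (x \in S) && (0 < rho A C Q x)].
have Pj : P j by rewrite /= jS.
case: (arg_minP (cost A Q T) Pj) => l /andP[lS rl] lmin.
by exists l; split=> // k kS rk; apply: lmin; rewrite /= kS.
Qed.

(** When the cheapest candidate fails the test, so do all the candidates. *)
Lemma acceptable_notin C f Q (T : 'M[R]_(size C)) (S : {set 'I_n}) l j :
  inv C f -> is_QR A Q T -> best_candidate A Q T S l ->
  f + cost A Q T l > threshold m n (size C) f ->
  acceptable C f j -> j \notin S.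
Proof.
move=> iC qr [_ _ lmin] gt_thr [rj cj]; apply/negP => jS.
have := lmin j jS; rewrite (rhoE _ iC qr) sqrtr_gt0 => /(_ rj).
rewrite !(costE _ iC qr) => le_c.
move: gt_thr; rewrite (costE _ iC qr); apply/negP; rewrite -leNgt.
apply: le_trans cj.
by rewrite lerD2l.
Qed.

Local Notation returns := (always_returns A kb g).

Lemma select_steps C f J B (S : {set 'I_n}) sel : inv C f ->
  exists t, step (Select C f J B S sel) t.
Proof.
move=> iC; have [Q [T qr]] := is_QR_exists iC.
have [Cm'|Cm'] := ltnP (size C) m; last first.
  eexists; apply: (@step_exit _ _ _ A kb g C f J B S sel Q T qr).
  by case; rewrite ltnNge Cm'.
case: (pickP (fun j => (j \in S) && (0 < rho A C Q j))) => [j /andP[jS rj]|none].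
  have [l lb] := best_exists T jS rj.
  have [gt_thr|/negP le_thr] := boolP (f + cost A Q T l > threshold m n (size C) f).
    by eexists; apply: step_reject gt_thr.
  by eexists; apply: step_accept (introN idP le_thr).
eexists; apply: (@step_exit _ _ _ A kb g C f J B S sel Q T qr).
by case=> _ [j jS rj]; have := none j; rewrite jS rj.
Qed.

(** The three possible outcomes of a step inside the selection loop, stated
    independently of the QR factorization used in that step. *)
Lemma step_select C f J B (S : {set 'I_n}) sel t : inv C f ->
  step (Select C f J B S sel) t ->
  [\/ (size C < m)%N /\
        exists l f', inv (rcons C l) f' /\
                     t = Select (rcons C l) f' J B (S :\ l) true,
      t = after_select sel C f (J :\: B) /\
        forall j, acceptable C f j -> j \notin S |
      t = after_select sel C f J /\
        ~ ((size C < m)%N /\ exists2 j, j \in S &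
             0 < sqn (resid (prefix_cols A (size C) C) (col j A)))].
Proof.
move=> iC st; have := @step_inv (Select C f J B S sel) t iC st.
move e: (Select C f J B S sel) st => s st.
case: s t / st e => // C0 f0 J0 B0 S0 sel0 Q T.
- move=> l Cm qr lb le_thr [? ? ? ? ? ?] it; subst C0 f0 J0 B0 S0 sel0.
  by apply: Or31; split=> //; exists l, (f + cost A Q T l).
- move=> l Cm qr lb gt_thr [? ? ? ? ? ?] it; subst C0 f0 J0 B0 S0 sel0.
  by apply: Or32; split=> // j; exact: acceptable_notin gt_thr.
- move=> qr stop [? ? ? ? ? ?] it; subst C0 f0 J0 B0 S0 sel0.
  apply: Or33; split=> // -[Cm [j jS rj]]; apply: stop; split=> //.
  by exists j => //; rewrite (rhoE _ iC qr) sqrtr_gt0.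
Qed.

Lemma step_draw C f J t : inv C f -> step (Draw C f J) t ->
  exists2 B, sample_outcome kb g J B &
    t = Draw C f (J :\: B) /\
      (forall j, j \in B -> sqn (resid (prefix_cols A (size C) C) (col j A)) <= 0) \/
    t = Select C f J B B false /\
      (exists2 j, j \in B & 0 < sqn (resid (prefix_cols A (size C) C) (col j A))).
Proof.
move=> iC; move e: (Draw C f J) => s st.
case: s t / st e => // C0 f0 J0 B Q T sB qr.
- move=> r0 [? ? ?]; subst C0 f0 J0; exists B => //; left; split=> // j /r0/eqP.
  by rewrite (rhoE _ iC qr) sqrtr_eq0.
- move=> rn0 [? ? ?]; subst C0 f0 J0; exists B => //; right; split=> //.
  pose r j := sqn (resid (prefix_cols A (size C) C) (col j A)).
  case: (pickP (fun j => (j \in B) && (0 < r j))) => [j /andP[]|none].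
    by exists j.
  case: rn0 => j jB; apply/eqP; rewrite (rhoE _ iC qr) sqrtr_eq0 leNgt.
  by have := none j; rewrite jB /= => ->.
Qed.

(** Induction on the size of the pool [J], which always contains an acceptable
    column: a step either selects a column or removes a nonempty block not
    containing it. *)
Lemma draw_returns C f (J : {set 'I_n}) : inv C f -> (size C < m)%N ->
  (forall l f' J' B S, inv (rcons C l) f' ->
     returns (Select (rcons C l) f' J' B S true)) ->
  (exists2 j, j \in J & acceptable C f j) -> returns (Draw C f J).
Proof.
move=> iC Cm IHC.
have [k] := ubnP #|J|; elim: k J => // k IHk J; rewrite ltnS => Jk [j jJ accj].
(* Sampled blocks are nonempty as [kb] and [#|J|] are positive. *)
have decr B : sample_outcome kb g J B -> (#|J :\: B| < k)%N.
  case=> BJ Bc _; apply: leq_trans Jk; rewrite cardsD (setIidPr BJ) Bc.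
  have J0 : (0 < #|J|)%N by apply/card_gt0P; exists j.
  by rewrite ltn_subrL J0 leq_min kb_gt0 J0.
apply: always_returns_next.
  have [B sB] := sample_exists J; have [Q [T qr]] := is_QR_exists iC.
  case: (boolP [forall x in B, rho A C Q x == 0]) => [/forall_inP z|nz].
    by eexists; apply: (@step_discard _ _ _ A kb g C f J B Q T sB qr) => x /z/eqP.
  eexists; apply: (@step_block _ _ _ A kb g C f J B Q T sB qr) => z; case/negP: nz.
  by apply/forall_inP => x /z ->.
move=> t /(step_draw iC)[B sB [[-> r0]|[-> [x xB rx]]]].
  apply: IHk; first exact: decr.
  exists j => //; rewrite inE jJ andbT; apply/negP => /r0.
  by rewrite leNgt; case: accj => ->.
apply: always_returns_next; first exact: select_steps.
move=> t' /(step_select iC)[[_ [l [f' [iC' ->]]]]|[-> nacc]|[-> []]].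
- exact: IHC.
- apply: IHk; first exact: decr.
  by exists j => //; rewrite inE jJ andbT nacc.
- by split=> //; exists x.
Qed.

(** Induction on the number [d] of columns still to be selected. *)
Lemma test_select_returns d C f : inv C f -> (m - size C = d)%N ->
  returns (Test C f) /\ forall J B S, returns (Select C f J B S true).
Proof.
elim: d C f => [|d IH] C f iC dE.
  have Cm : size C = m by apply/eqP; rewrite eqn_leq (inv_le iC) -subn_eq0 dE.
  have tC : returns (Test C f) by apply: always_returns_done.
  split=> // J B S; apply: always_returns_next; first exact: select_steps.
  by move=> t /(step_select iC)[[]|[->]|[->]] //; rewrite Cm ltnn.
have Cm : (size C < m)%N by rewrite -subn_gt0 dE.
have IHC l f' J' B S : inv (rcons C l) f' ->
    returns (Select (rcons C l) f' J' B S true).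
  move=> iC'; have [|_] := IH _ _ iC'; last exact.
  by rewrite size_rcons subnS dE.
have tC : returns (Test C f).
  apply: always_returns_next; first by eexists; apply: step_start.
  move=> t; move e: (Test C f) => s st.
  case: s t / st e => // C0 f0 _ [? ?]; subst C0 f0.
  apply: draw_returns => //.
  have [j jC accj] := inv_acceptable iC Cm.
  by exists j => //; rewrite !inE.
split=> // J B S; apply: always_returns_next; first exact: select_steps.
by move=> t /(step_select iC)[[_ [l [f' [iC' ->]]]]|[->]|[->]] //; apply: IHC.
Qed.

End Execution.

Theorem theorem5p1 (R : realType) (n m : nat) (Z : 'M[R]_(n, m))
    (kb : nat) (g : 'I_n -> R)
    (hZ : Z^T *m Z = 1%:M)
    (hkb : (1 <= kb)%N)
    (hg_ge0 : forall j, 0 <= g j)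
    (hg_gt0 : forall j, col j Z^T != 0 -> 0 < g j) :
  randBSQR_terminates Z^T kb g /\
  forall C : m.-tuple 'I_n, randBSQR_returns Z^T kb g C ->
  forall i : nat, (1 <= i <= m)%N ->
    sigma i (rowsub (tnth C) Z) >=
      1 / Num.sqrt (1 + i%:R * (n%:R - m%:R) / (m%:R - i%:R + 1)).
Proof.
have AA : Z^T *m Z^T^T = 1%:M by rewrite trmxK.
split.
  by have [] := test_select_returns g AA hkb (selection_inv_nil Z^T) (erefl _).
move=> C [_ [f /reachable_inv /= [_ uC _ prefixP]]] i /andP[i0 im].
rewrite size_tuple in prefixP.
have [Giu tri] := prefixP i im; have [Gmu _] := prefixP m (leqnn m).
set L := 1 + _.
have m_i : 0 < m%:R - i%:R + 1 :> R by rewrite ltr_wpDl // subr_ge0 ler_nat.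
have trL : \tr (invmx (gram (prefix_cols Z^T i C))) <= i%:R - 1 + L.
  apply: (le_trans tri); rewrite /trace_bound /L le_eqVlt; apply/orP; left.
  by apply/eqP; field; rewrite gt_eqF.
have iC : (i <= size C)%N by rewrite size_tuple.
(* [|x|^2 <= L |M_i x|^2] for the matrix [M_i] of the first [i] columns. *)
have lowP := contraction_trace_bound
  (fun x => prefix_cols_contraction AA x uC iC) Giu trL.
have L_gt0 : 0 < L.
  have e_gt0 : 0 < sqn (delta_mx (Ordinal i0) 0 : 'cV[R]_i).
    rewrite sqn_gt0; apply/eqP => /matrixP/(_ (Ordinal i0) 0)/eqP.
    by rewrite !mxE !eqxx oner_eq0.
  rewrite ltNge; apply/negP => L0; have := lt_le_trans e_gt0 (lowP _).
  by rewrite ltNge mulr_le0_ge0 ?sqn_ge0.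
set M := rowsub (tnth C) Z.
have MT : M^T = prefix_cols Z^T m C.
  apply/matrixP => a j; rewrite (prefix_colsE _ _ _ (tnth C j)) ?size_tuple //.
  by rewrite !mxE; congr (Z _ a); exact: tnth_nth.
rewrite div1r -sqrtrV ?(ltW L_gt0) //.
apply: (@sigma_ge _ _ i _ (pid_mx i)) => //.
- by move: Gmu; rewrite /gram -MT trmxK unitmx_mul => /andP[].
- by rewrite tr_pid_mx pid_mx_id // pid_mx_1.
(* [M_i] is obtained from all [m] columns by composing with the inclusion of the
   first [i] coordinates. *)
- move=> x; rewrite MT mulmxA prefix_cols_pid //.
  by rewrite mulrC ler_pdivrMr // mulrC.
Qed.
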